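(* Let $K$ be a global function field of odd characteristic with set of places $X$. Let $\mathscr{B}=\{\beta_1,\dots,\beta_n\}$ be a basis of $\mathbb{E}$ and $\mathfrak{B}=\{\mathfrak{b}_1,\dots,\mathfrak{b}_n\}\subset X$ a compatible set of places. Let $\mathfrak{S}\subset X$ be a finite set disjoint from $\mathfrak{B}$ and let $\mathfrak{S}'\subseteq\mathfrak{S}$ be a maximal subset of $\mathfrak{S}$ linearly independent in $\operatorname{Pic}X/2\operatorname{Pic}X$. Write $\mathfrak{S}\setminus\mathfrak{S}'=\{\mathfrak{p}_1,\dots,\mathfrak{p}_s\}$ and for each $j\in\{1,\dots,s\}$ let $\lambda_j\in K^\times$ be an $(\mathfrak{S}'\cup\{\mathfrak{p}_j\})$-singular element such that $\operatorname{ord}_{\mathfrak{p}_j}\lambda_j\equiv1\pmod2$ and $\left(\frac{\lambda_j}{\mathfrak{b}}\right)=1$ for every $\mathfrak{b}\in\mathfrak{B}$, so that $\mathscr{A}:=\{\beta_1,\dots,\beta_n\}\cup\{\lambda_1,\dots,\lambda_s\}$ is a basis of $\mathbb{E}_\mathfrak{S}$. If $\mu\in K^\times$ is $\mathfrak{S}$-singular, then its coordinates $(\varepsilon_1,\dots,\varepsilon_n;e_1,\dots,e_s)$ with respect to $\mathscr{A}$ (that is, $\varepsilon_i,e_j\in\{0,1\}$ with $\mu\equiv\beta_1^{\varepsilon_1}\cdots\beta_n^{\varepsilon_n}\lambda_1^{e_1}\cdots\lambda_s^{e_s}$ modulo $K^{\times2}$) satisfy $$(-1)^{\varepsilon_i}=\left(\frac{\mu}{\mathfrak{b}_i}\right)\qquad\text{and}\qquad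 e_j\equiv\operatorname{ord}_{\mathfrak{p}_j}\mu\pmod2$$ for all $i\in\{1,\dots,n\}$ and $j\in\{1,\dots,s\}$.
   Context: $K$ is a global function field of odd characteristic with full constant field $\mathbb{F}_q$ ($q$ a power of an odd prime). $X$ is the set of places of $K$, viewed as a smooth complete curve over $\mathbb{F}_q$. For $\mathfrak{p}\in X$, $\operatorname{ord}_\mathfrak{p}$ is the normalized valuation and $K_\mathfrak{p}$ the completion. $\operatorname{Pic}X$ is the group of divisor classes and $[\mathcal{D}]$ the class of the divisor $\mathcal{D}$. For a finite set $\mathfrak{S}\subset X$, an element $\lambda\in K^\times$ is $\mathfrak{S}$-singular if $\operatorname{ord}_\mathfrak{p}\lambda$ is even for every $\mathfrak{p}\in X\setminus\mathfrak{S}$. The group of $\mathfrak{S}$-singular elements modulo squares is $\mathbb{E}_\mathfrak{S}=\{\lambda\in K^\times/K^{\times2} : \operatorname{ord}_\mathfrak{p}\lambda\equiv0\pmod2\text{ for }\mathfrak{p}\in X\setminus\mathfrak{S}\}$, a finite $\mathbb{F}_2$-vector space; $\mathbb{E}:=\mathbb{E}_\emptyset$. Elements of $K^\times$ are identified with their square classes where appropriate. For $\lambda\in K^\times$ (or its square class), $\left(\frac{\lambda}{\mathfrak{p}}\right)$ equals $1$ if $\lambda$ is a square in $K_\mathfrak{p}$, $0$ if $\operatorname{ord}_\mathfrak{p}\lambda$ is odd, and $-1$ if $\operatorname{ord}_\mathfrak{p}\lambda$ is even but $\lambda$ is not a square in $K_\mathfrak{p}$. Distinct places are said to be linearly independent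 in $\operatorname{Pic}X/2\operatorname{Pic}X$ if the family of cosets of their classes modulo $2\operatorname{Pic}X$ is linearly independent over $\mathbb{F}_2$. Sets $\{\mathfrak{b}_1,\dots,\mathfrak{b}_n\}\subset X$ and $\{\beta_1,\dots,\beta_n\}\subset\mathbb{E}$ are compatible if $\left(\frac{\beta_i}{\mathfrak{b}_i}\right)=-1$ for all $i$ and $\left(\frac{\beta_i}{\mathfrak{b}_j}\right)=1$ for all $i\ne j$. *)

(* Defs.v *)
From HB Require Import structures.
From mathcomp Require Import all_boot all_order all_algebra all_field.
From mathcomp Require Import finmap.
From mathcomp Require Import boolp classical_sets functions.
From mathcomp Require Import freeg.

Set Implicit Arguments.
Unset Strict Implicit.
Unset Printing Implicit Defensive.

Import Order.TTheory GRing.Theory Num.Theory.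
Local Open Scope ring_scope.
Local Open Scope quotient_scope.

(* A global function field over the finite field F is a finite extension K of
   F(t) = {fraction {poly F}}. *)
Definition constant (F : finFieldType) (K : fieldExtType {fraction {poly F}})
  (c : F) : K := (tofrac c%:P)%:A.

Definition full_constant_field
    (F : finFieldType) (K : fieldExtType {fraction {poly F}}) : Prop :=
  forall x : K, algebraicOver (@constant F K) x -> exists c : F, x = constant K c.

(* A place is its normalized discrete valuation.  Discrete valuations on a
   global function field are trivial on the finite constant field, so this need
   not be required.  The value +oo at 0 is replaced by the junk value 0, fixed
   so that a place is determined by the valuation on nonzero elements. *)
Record place (K : fieldType) : Type := Place {
  ord :> K -> int;
  ord0 : ord 0 = 0;
  ordM : forall x y, x != 0 -> y != 0 -> ord (x * y) = ord x + ord y;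
  ordD : forall x y, x != 0 -> y != 0 -> x + y != 0 ->
    Num.min (ord x) (ord y) <= ord (x + y);
  ord_normalized : exists x, ord x = 1
}.

HB.instance Definition _ (K : fieldType) := gen_eqMixin (place K).
HB.instance Definition _ (K : fieldType) := gen_choiceMixin (place K).

Section Completion.
Variables (K : fieldType) (p : place K).
Implicit Types (x y : K) (u v : nat -> K).

(* N <= ord x, with ord 0 = +oo *)
Definition ord_ge (N : int) x : bool := (x == 0) || (N <= p x).

Definition cauchy u : bool :=
  `[< forall N : int, exists M : nat, forall m n : nat,
        (M <= m)%N -> (M <= n)%N -> ord_ge N (u m - u n) >].

Definition tends_to0 u : bool :=
  `[< forall N : int, exists M : nat, forall n : nat,
        (M <= n)%N -> ord_ge N (u n) >].

Lemma ord1 : p 1 = 0.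
Proof.
have /eqP := ordM p (oner_neq0 K) (oner_neq0 K).
by rewrite mulr1 -subr_eq0 opprD addrA subrr add0r oppr_eq0 => /eqP.
Qed.

Lemma ordN x : p (- x) = p x.
Proof.
have N1 : (-1 : K) != 0 by rewrite oppr_eq0 oner_neq0.
have pN1 : p (-1) = 0.
  have := ordM p N1 N1; rewrite mulrNN mulr1 ord1 => /esym/eqP.
  by rewrite -mulr2n mulrn_eq0 => /eqP.
have [->|x0] := eqVneq x 0; first by rewrite oppr0.
by rewrite -mulN1r ordM // pN1 add0r.
Qed.

Lemma ord_ge0 N : ord_ge N 0. Proof. by rewrite /ord_ge eqxx. Qed.

Lemma ord_geN N x : ord_ge N (- x) = ord_ge N x.
Proof. by rewrite /ord_ge oppr_eq0 ordN. Qed.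

Lemma ord_geW N M x : M <= N -> ord_ge N x -> ord_ge M x.
Proof.
by move=> MN /orP[/eqP->|Nx]; rewrite /ord_ge ?eqxx // (le_trans MN Nx) orbT.
Qed.

Lemma ord_geD N x y : ord_ge N x -> ord_ge N y -> ord_ge N (x + y).
Proof.
rewrite /ord_ge; have [->|x0] := eqVneq x 0; first by rewrite add0r.
have [->|y0] := eqVneq y 0; first by rewrite addr0 (negPf x0).
have [//|xy0] := eqVneq (x + y) 0 => /= hx hy.
by apply: le_trans (ordD p x0 y0 xy0); rewrite le_min hx.
Qed.

Lemma ord_geM N M x y : ord_ge N x -> ord_ge M y -> ord_ge (N + M) (x * y).
Proof.
rewrite /ord_ge mulf_eq0; have [//|x0] := eqVneq x 0.
by have [//|y0] := eqVneq y 0 => /= hx hy; rewrite ordM // lerD.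
Qed.

Lemma ord_ge_ex x : exists N, ord_ge N x.
Proof. by exists (p x); rewrite /ord_ge lexx orbT. Qed.

Lemma cauchy_bounded u : cauchy u -> exists N, forall n, ord_ge N (u n).
Proof.
move=> /asboolP/(_ 0) [M hM].
have [N0 hN0] : exists N, forall n, (n <= M)%N -> ord_ge N (u n).
  elim: M {hM} => [|M [N hN]].
    by have [N hN] := ord_ge_ex (u 0%N); exists N => n; rewrite leqn0 => /eqP->.
  have [N' hN'] := ord_ge_ex (u M.+1); exists (Num.min N N') => n.
  rewrite leq_eqVlt => /orP[/eqP->|].
    by apply: ord_geW hN'; rewrite ge_min lexx orbT.
  by rewrite ltnS => /hN; apply: ord_geW; rewrite ge_min lexx.
exists (Num.min N0 0) => n; have [nM|/ltnW Mn] := leqP n M.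
  by apply: ord_geW (hN0 _ nM); rewrite ge_min lexx.
rewrite -(subrK (u M) (u n)); apply: ord_geD.
  by apply: ord_geW (hM _ _ Mn (leqnn _)); rewrite ge_min lexx orbT.
by apply: ord_geW (hN0 _ (leqnn _)); rewrite ge_min lexx.
Qed.

Lemma cauchy_cst x : cauchy (fun=> x).
Proof. by apply/asboolP => N; exists 0%N => m n _ _; rewrite subrr ord_ge0. Qed.

Lemma cauchy_subring_closed : subring_closed cauchy.
Proof.
split=> [|u v|u v]; first exact: cauchy_cst.
- move=> /asboolP hu /asboolP hv; apply/asboolP => N.
  have [M1 h1] := hu N; have [M2 h2] := hv N.
  exists (maxn M1 M2) => m n; rewrite !geq_max => /andP[m1 m2] /andP[n1 n2].
  have -> : (u - v) m - (u - v) n = (u m - u n) - (v m - v n).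
    change (u m - v m - (u n - v n) = (u m - u n) - (v m - v n)).
    by rewrite opprD addrACA -opprD.
  by apply: ord_geD; [apply: h1|rewrite ord_geN; apply: h2].
- move=> cu cv; have [Bu hBu] := cauchy_bounded cu.
  have [Bv hBv] := cauchy_bounded cv.
  move: cu cv => /asboolP hu /asboolP hv; apply/asboolP => N.
  have [M1 h1] := hu (N - Bv); have [M2 h2] := hv (N - Bu).
  exists (maxn M1 M2) => m n; rewrite !geq_max => /andP[m1 m2] /andP[n1 n2].
  have -> : (u * v) m - (u * v) n = (u m - u n) * v m + u n * (v m - v n).
    change (u m * v m - u n * v n = (u m - u n) * v m + u n * (v m - v n)).
    by rewrite mulrBl mulrBr addrA subrK.
  apply: ord_geD; first by rewrite -(subrK Bv N); apply: ord_geM; [apply: h1|].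
  by rewrite -(subrK Bu N) addrC; apply: ord_geM => //; apply: h2.
Qed.

HB.instance Definition _ :=
  GRing.isSubringClosed.Build (nat -> K) cauchy cauchy_subring_closed.

Record cauchy_seq : Type := CauchySeq {
  cauchy_val : nat -> K;
  cauchy_valP : cauchy cauchy_val
}.

HB.instance Definition _ := [isSub for cauchy_val].
HB.instance Definition _ := [Choice of cauchy_seq by <:].
HB.instance Definition _ :=
  [SubChoice_isSubComNzRing of cauchy_seq by <:].

Definition null_ideal (u : cauchy_seq) : bool := tends_to0 (val u).

Lemma null_ideal_closed : idealr_closed null_ideal.
Proof.
split=> [||u v w /asboolP hv /asboolP hw].
- by apply/asboolP => N; exists 0%N => n _; rewrite raddf0 ord_ge0.
- apply/asboolPn => /(_ 1) [M /(_ M (leqnn M))].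
  by rewrite rmorph1 /ord_ge oner_eq0 ord1.
- have [B hB] := cauchy_bounded (cauchy_valP u); apply/asboolP => N.
  have [M1 h1] := hv (N - B); have [M2 h2] := hw N.
  exists (maxn M1 M2) => n; rewrite geq_max => /andP[n1 n2].
  rewrite rmorphD rmorphM; apply: ord_geD; last exact: h2.
  by rewrite -(subrK B N) addrC; apply: ord_geM; [apply: hB|apply: h1].
Qed.

HB.instance Definition _ := isIdealr.Build cauchy_seq null_ideal null_ideal_closed.

Definition null_seqs : idealr cauchy_seq := null_ideal.

(* Cauchy sequences modulo null sequences; only the ring structure of this field
   is needed to speak of squares. *)
Definition completion : comNzRingType := {ideal_quot null_seqs}.

Definition to_completion x : completion :=
  \pi_{ideal_quot null_seqs} (CauchySeq (cauchy_cst x)).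

Definition local_square x : Prop :=
  exists z : completion, to_completion x = z ^+ 2.

Definition residue_symbol x : int :=
  if `[< local_square x >] then 1
  else if (p x == 1 %[mod 2])%Z then 0 else -1.

End Completion.

Section Picard.
Variable K : fieldType.

Notation divisor := {freeg (place K) / int}.

Definition principal (D : divisor) : bool :=
  `[< exists2 f : K, f != 0 & forall p : place K, coeff p D = p f >].

Lemma principal_zmod_closed : zmod_closed principal.
Proof.
split=> [|D E /asboolP[f f0 hf] /asboolP[g g0 hg]]; apply/asboolP.
  by exists 1 => [|p]; rewrite ?oner_neq0 // coeff0 ord1.
exists (f / g) => [|p]; first by rewrite mulf_neq0 ?invr_neq0.
rewrite coeffB hf hg; apply/eqP; rewrite subr_eq -ordM ?divfK //.
by rewrite mulf_neq0 ?invr_neq0.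
Qed.

Definition principal_divisors : zmodClosed divisor :=
  HB.pack principal
    (GRing.isZmodClosed.Build divisor principal principal_zmod_closed).

Definition Pic : zmodType := {ideal_quot principal_divisors}.

Definition divisor_class (D : divisor) : Pic := \pi_{ideal_quot principal_divisors} D.

Definition twice (c : Pic) : bool := `[< exists d : Pic, c = d *+ 2 >].

Lemma twice_zmod_closed : zmod_closed twice.
Proof.
split=> [|c d /asboolP[c' ->] /asboolP[d' ->]]; apply/asboolP.
  by exists 0; rewrite mul0rn.
by exists (c' - d'); rewrite mulrnBl.
Qed.

Definition two_Pic : zmodClosed Pic :=
  HB.pack twice (GRing.isZmodClosed.Build Pic twice twice_zmod_closed).

Definition Pic_mod2 : zmodType := {ideal_quot two_Pic}.

Definition place_class (p : place K) : Pic_mod2 :=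
  \pi_{ideal_quot two_Pic} (divisor_class << p >>).

(* F_2-linear independence in the elementary abelian 2-group Pic / 2 Pic, with
   the scalars of F_2 written as booleans. *)
Definition independent_places (T : {fset place K}) : Prop :=
  forall c : place K -> bool,
    \sum_(p <- T) place_class p *+ c p = 0 -> forall p, p \in T -> c p = false.

Definition maximal_independent (S T : {fset place K}) : Prop :=
  [/\ (T `<=` S)%fset, independent_places T &
      forall U : {fset place K}, (T `<=` U)%fset -> (U `<=` S)%fset ->
        independent_places U -> U = T].

End Picard.

(* Elements of K^* / K^*2 are given by representatives in K^*. *)

Section Singular.
Variable K : fieldType.

Definition eq_mod_squares (x y : K) : Prop :=
  exists2 z : K, z != 0 & x = y * z ^+ 2.

Definition singular (S : {fset place K}) (x : K) : Prop :=
  x != 0 /\ forall p : place K, p \notin S -> (p x = 0 %[mod 2])%Z.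

(* The square classes of the a i form a basis of the F_2-vector space of
   S-singular elements modulo squares; its group law is multiplication. *)
Definition singular_basis (S : {fset place K}) (I : finType) (a : I -> K) : Prop :=
  [/\ forall i, singular S (a i),
      forall c : I -> bool,
        eq_mod_squares (\prod_i a i ^+ c i) 1 -> forall i, c i = false &
      forall x, singular S x ->
        exists c : I -> bool, eq_mod_squares x (\prod_i a i ^+ c i)].

Definition compatible (n : nat) (beta : 'I_n -> K) (b : 'I_n -> place K) : Prop :=
  (forall i, residue_symbol (b i) (beta i) = -1) /\
  (forall i j, i != j -> residue_symbol (b j) (beta i) = 1).

End Singular.

(* Main.v *)
(* The coordinates are read off directly: ord_{p_j} has odd value on exactly one
   element of A, namely lambda_j, and beta_i is the only element of A that is
   not a square at b_i.  This also gives independence.  For spanning, multiply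
   an S-singular x by the lambda_j with ord_{p_j} x odd; the result is
   S'-singular, and independence of S' in Pic X / 2 Pic X forces its divisor to
   be even, so that it lies in the span of B.

   The last step needs principal divisors to be finite.  Given m places where x
   has positive valuation, approximation yields u_1, ..., u_m such that the
   x^a u_i are linearly independent over F; for a < A they all lie, up to a
   common denominator, in a space of F-dimension at most C A + D with C
   depending only on x, whence m <= C. *)
From HB Require Import structures.
From mathcomp Require Import boolp freeg.
Require Import Defs.
From mathcomp Require Import all_boot all_order all_algebra all_field.
From mathcomp Require Import finmap zify ring.

Set Implicit Arguments.
Unset Strict Implicit.
Unset Printing Implicit Defensive.

Import Order.TTheory GRing.Theory Num.Theory.
Local Open Scope ring_scope.

(** * Places as valuations, and separation of one place from finitely many others *)

Section Valuations.
Variable K : fieldType.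
Implicit Types (v w : place K) (x y z : K).

Lemma place_eq v w : v =1 w -> v = w.
Proof.
case: v w => [f f0 fM fD f1] [g g0 gM gD g1] /= /funext fg.
by case: _ / fg in g0 gM gD g1 *; congr Place; apply: Prop_irrelevance.
Qed.

(* The statements of [ordM] and [ordD] go through join instances that [lia]
   fails to identify with the usual ones. *)
Lemma ord_mul v x y : x != 0 -> y != 0 -> v (x * y) = v x + v y.
Proof. exact: ordM. Qed.

Lemma ord_add v x y : x != 0 -> y != 0 -> x + y != 0 ->
  (v x <= v (x + y)) || (v y <= v (x + y)).
Proof. by move=> x0 y0 xy0; have := ordD v x0 y0 xy0; rewrite ge_min. Qed.

Lemma ordV v x : v x^-1 = - v x.
Proof.
have [->|x0] := eqVneq x 0; first by rewrite invr0 Defs.ord0.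
apply/eqP; rewrite -addr_eq0 addrC -ord_mul ?invr_eq0 //.
by rewrite divff // Defs.ord1.
Qed.

Lemma ordX v x k : v (x ^+ k) = v x *+ k.
Proof.
have [->|x0] := eqVneq x 0.
  by rewrite expr0n Defs.ord0 mul0rn; case: k => [|k]; rewrite ?Defs.ord1 ?Defs.ord0.
elim: k => [|k IH]; first by rewrite expr0 Defs.ord1.
by rewrite exprS ord_mul ?expf_neq0 // IH mulrS.
Qed.

Lemma ordXz v x (k : int) : v (x ^ k) = v x * k.
Proof.
case: k => k; first by rewrite -exprnP ordX -mulr_natr natz.
by rewrite NegzE -exprnN ordV ordX mulrN -mulr_natr natz.
Qed.

Lemma ord_prod v (I : finType) (f : I -> K) :
  (forall i, f i != 0) -> v (\prod_i f i) = \sum_i v (f i).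
Proof.
move=> f0; suff [] : \prod_i f i != 0 /\ v (\prod_i f i) = \sum_i v (f i) by [].
elim/big_rec2: _ => [|i a b _ [b0 <-]]; first by rewrite Defs.ord1 oner_neq0.
by rewrite mulf_neq0 // ord_mul.
Qed.

Lemma ordD_lt v x y : x != 0 -> y != 0 -> v x < v y ->
  x + y != 0 /\ v (x + y) = v x.
Proof.
move=> x0 y0 xy.
have xy0 : x + y != 0.
  by apply: contraTneq xy => /eqP; rewrite addr_eq0 => /eqP ->; rewrite ordN ltxx.
split=> //; have := ord_add v x0 y0 xy0.
have := @ord_add v (x + y) (- y) xy0; rewrite oppr_eq0 addrK ordN => /(_ y0 x0).
lia.
Qed.

Lemma ord_neq0 v x : v x != 0 -> x != 0.
Proof. by apply: contra_neq => ->; rewrite Defs.ord0. Qed.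

Lemma ord_1Dlt v x : v x < 0 -> 1 + x != 0 /\ v (1 + x) = v x.
Proof.
move=> x0; rewrite addrC; apply: ordD_lt; rewrite ?oner_neq0 ?Defs.ord1 //.
by apply: (@ord_neq0 v); lia.
Qed.

Lemma ord_1Dgt v x : 0 < v x -> 1 + x != 0 /\ v (1 + x) = 0.
Proof.
move=> x0; rewrite -[RHS](Defs.ord1 v); apply: ordD_lt; rewrite ?oner_neq0 ?Defs.ord1 //.
by apply: (@ord_neq0 v); lia.
Qed.

(** Applied to [x] and [x^-1], the hypothesis sends units of [v] to units of [w], so [w] is [w t]
    times [v] for a uniformizer [t] of [v]. As [w] takes the value 1, [w t] divides 1, and it is
    nonnegative. *)
Lemma place_eq_of_nneg v w :
  (forall x, x != 0 -> 0 <= v x -> 0 <= w x) -> v = w.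
Proof.
move=> vw.
have vw0 x : x != 0 -> v x = 0 -> w x = 0.
  move=> x0 vx; have := vw x x0; rewrite vx lexx => /(_ isT).
  have := vw x^-1; rewrite invr_eq0 !ordV vx oppr0 lexx => /(_ x0 isT).
  by lia.
have [t vt] := ord_normalized v.
have t0 : t != 0 by apply: (@ord_neq0 v); rewrite vt.
have wE x : x != 0 -> w x = w t * v x.
  move=> x0; have y0 : t ^ (- v x) != 0 by rewrite expfz_neq0.
  have := @vw0 (x * t ^ (- v x)); rewrite mulf_neq0 // !ord_mul // !ordXz vt.
  by move=> /(_ isT); lia.
have [u wu] := ord_normalized w.
have u0 : u != 0 by apply: (@ord_neq0 w); rewrite wu.
have wt : w t = 1.
  have := vw t t0; rewrite vt => /(_ isT); have := wE u u0; rewrite wu.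
  case: (w t) => // a /esym/eqP + _; rewrite mulrC intUnitRing.mulzn_eq1.
  by case/andP=> _ /eqP->.
apply: place_eq => x; have [->|x0] := eqVneq x 0; first by rewrite !Defs.ord0.
by rewrite wE // wt mul1r.
Qed.

(** Neither valuation ring contains the other; a quotient of witnesses for the two non-inclusions
    separates. *)
Lemma ord_separate v w : v <> w -> exists z, v z < 0 /\ 0 < w z.
Proof.
move=> vw.
have key (v1 v2 : place K) : v1 <> v2 -> exists x, [/\ x != 0, 0 <= v1 x & v2 x < 0].
  move=> /eqP; apply: contra_neqP => H; apply: place_eq_of_nneg => x x0 vx.
  by rewrite leNgt; apply/negP => wx; apply: H; exists x.
have [x [x0 vx wx]] := key _ _ vw.
have [y [y0 wy vy]] := key _ _ (nesym vw).
exists (y / x); rewrite !ord_mul ?invr_eq0 // !ordV; lia.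
Qed.

(* Artin-Whaples: if z serves for the tail s, then z^r / (1 + z^r) * y or
   z^r * y repairs it at the new place w, where y separates v from w. *)
Lemma ord_separate_seq v (s : seq (place K)) : v \notin s ->
  exists z, v z < 0 /\ forall w, w \in s -> 0 < w z.
Proof.
elim: s => [_|w s IH].
  have [t vt] := ord_normalized v; exists t^-1.
  by rewrite ordV vt; split=> // w; rewrite in_nil.
rewrite in_cons negb_or => /andP[/eqP vw /IH[z [vz sz]]].
have [y [vy wy]] := ord_separate vw.
have z0 : z != 0 by apply: (@ord_neq0 v); lia.
have y0 : y != 0 by apply: (@ord_neq0 v); lia.
(* A large power of [z] outweighs any pole of [y] at the places of [s]. *)
have [r hr] : exists r : nat, (0 < r)%N /\ forall u : place K, u \in s -> 0 < u z *+ r + u y.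
  elim: s {IH} sz => [|u s IH] sz; first by exists 1%N.
  have [|r [r0 hr]] := IH; first by move=> u' u's; apply: sz; rewrite in_cons u's orbT.
  exists (r + `|u y|).+1%N; split=> // u'.
  have [u's|] := boolP (u' \in s).
    by move=> _; have := hr u' u's; have := sz u'; rewrite in_cons u's orbT; nia.
  rewrite in_cons => /negPf->; rewrite orbF => /eqP->.
  by have := sz u; rewrite in_cons eqxx; nia.
have [wz|wz|wz] := ltgtP (w z) 0.
(* The factor [z ^+ r / (1 + z ^+ r)] has order 0 at the poles [v] and [w] of [z], where [y] alone
   decides, and order [u z *+ r] at the zeros [u] in [s]. *)
- have zr (u : place K) : u (z ^+ r) = u z *+ r by rewrite ordX.
  have [vr0 vr] : 1 + z ^+ r != 0 /\ v (1 + z ^+ r) = v (z ^+ r).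
    by apply: ord_1Dlt; rewrite zr; lia.
  have uE (u : place K) : u (z ^+ r / (1 + z ^+ r) * y) = u z *+ r - u (1 + z ^+ r) + u y.
    by rewrite !ord_mul ?mulf_neq0 ?invr_eq0 ?expf_neq0 // zr ordV.
  exists (z ^+ r / (1 + z ^+ r) * y); rewrite uE; split; first by rewrite vr zr; lia.
  move=> u; rewrite in_cons uE => /orP[/eqP->|us].
    have [_ ->] : 1 + z ^+ r != 0 /\ w (1 + z ^+ r) = w (z ^+ r).
      by apply: ord_1Dlt; rewrite zr; lia.
    by rewrite zr; lia.
  have [_ ->] : 1 + z ^+ r != 0 /\ u (1 + z ^+ r) = 0.
    by apply: ord_1Dgt; rewrite zr; have := sz u us; nia.
  by rewrite subr0; apply: hr.2.
- exists z; split=> // u; rewrite in_cons => /orP[/eqP->//|]; exact: sz.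
- have uE (u : place K) : u (z ^+ r * y) = u z *+ r + u y by rewrite ord_mul ?expf_neq0 // ordX.
  exists (z ^+ r * y); rewrite uE; split; first by lia.
  move=> u; rewrite in_cons uE => /orP[/eqP->|us]; first by rewrite wz mul0rn add0r.
  exact: hr.2.
Qed.

Lemma ord_ge_sum v N (I : finType) (P : pred I) (f : I -> K) :
  (forall i, P i -> ord_ge v N (f i)) -> ord_ge v N (\sum_(i | P i) f i).
Proof. move=> h; apply: (big_ind (fun x => ord_ge v N x)) => //; first exact: ord_ge0.
by move=> x y; apply: ord_geD. Qed.

Lemma sum_neq0_ord v (I : finType) (f : I -> K) i0 : f i0 != 0 ->
  (forall i, i != i0 -> ord_ge v (v (f i0) + 1) (f i)) -> \sum_i f i != 0.
Proof.
move=> f0 h; rewrite (bigD1 i0) //= addr_eq0.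
have: ord_ge v (v (f i0) + 1) (- \sum_(i | i != i0) f i).
  by rewrite ord_geN; apply: ord_ge_sum => i; apply: h.
apply: contraTneq => <-; rewrite /ord_ge (negPf f0) /=; lia.
Qed.

End Valuations.

(** * A function has finitely many zeros and poles *)

Section FunctionField.
Variables (F : finFieldType) (K : fieldExtType {fraction {poly F}}).
Implicit Types (v : place K) (x y : K) (p d : {poly F}).

Definition polyK : {poly F} -> K := in_alg K \o @tofrac {poly F}.

HB.instance Definition _ :=
  GRing.RMorphism.copy polyK (in_alg K \o @tofrac {poly F}).

Local Notation "p %:K" := (polyK p) (at level 2, format "p %:K").

Lemma polyK_eq0 p : (p%:K == 0) = (p == 0).
Proof. by rewrite /polyK /= scaler_eq0 oner_eq0 orbF tofrac_eq0. Qed.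

(** From [c ^+ #|F| = c], the order is killed by [#|F| - 1], which is positive. *)
Lemma ord_constant v (c : F) : c != 0 -> v c%:P%:K = 0.
Proof.
move=> c0; set y := c%:P%:K.
have: y ^+ #|F| = y by rewrite -rmorphXn -polyC_exp expf_card.
move/(congr1 v); rewrite ordX => /eqP; rewrite -subr_eq0.
have := finNzRing_gt1 F; case: #|F| => [|[|q]] // _.
by rewrite mulrS addrAC subrr add0r mulrn_eq0 => /eqP.
Qed.

(* If a relation held, the valuation separating one index from the others would
   single out the nonzero term of least x-degree. *)
Lemma separated_powers_free x m A (v : 'I_m -> place K) (u : 'I_m -> K) :
  (forall i, 0 < v i x) ->
  (forall i, v i (u i) < 0) -> (forall i j, i != j -> 0 < v i (u j)) ->
  forall c : 'I_m * 'I_A -> F,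
    \sum_k (c k)%:P%:K * (x ^+ k.2 * u k.1) = 0 -> forall k, c k = 0.
Proof.
move=> vx vu vuu c sum0 k; apply/eqP; apply: contraT => ck; move/eqP: sum0.
case: (@arg_minnP _ k (fun k => c k != 0) (fun k => k.2 : nat) ck) => -[i a] /= cia amin.
apply: contraTT => _.
have x0 : x != 0 by apply: (@ord_neq0 _ (v i)); rewrite gt_eqF.
have u0 j : u j != 0 by apply: (@ord_neq0 _ (v j)); rewrite lt_eqF.
have t0 l : c l != 0 -> (c l)%:P%:K * (x ^+ l.2 * u l.1) != 0.
  by move=> cl; rewrite !mulf_neq0 ?expf_neq0 // polyK_eq0 polyC_eq0.
have vt l : c l != 0 ->
    v i ((c l)%:P%:K * (x ^+ l.2 * u l.1)) = v i x *+ l.2 + v i (u l.1).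
  move=> cl; rewrite ord_mul ?mulf_neq0 ?expf_neq0 ?polyK_eq0 ?polyC_eq0 //.
  by rewrite ord_constant // add0r ord_mul ?expf_neq0 // ordX.
apply: (@sum_neq0_ord _ (v i) _ _ (i, a)); first exact: t0.
move=> [j b] jb; have [cjb|cjb] := eqVneq (c (j, b)) 0.
  by rewrite cjb !rmorph0 mul0r ord_ge0.
rewrite /ord_ge; apply/orP; right; rewrite !vt //=.
(* Here [a <= b]. If [j = i] then [a < b] and the extra powers of [x] raise the order at [v i];
   otherwise [v i (u i) < 0 < v i (u j)] does. *)
have := amin _ cjb; rewrite /= => ab; have := vx i; have := vu i.
have [eji|nij] := eqVneq j i; last by have := vuu i j; rewrite eq_sym nij => /(_ isT); nia.
have : (a != b) by apply: contra_neq jb => ->; rewrite eji.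
by rewrite -val_eqE eji /=; nia.
Qed.

Local Notation N := (\dim {:K}).
Local Notation e i := ((vbasis {:K})`_i).

(* Combinations of the chosen F(t)-basis of K with polynomial coefficients of
   degree < D. *)
Definition lattice D y : Prop :=
  exists2 c : 'I_N -> {poly F},
    forall i, (size (c i) <= D)%N & y = \sum_i (c i)%:K * e i.

Lemma latticeW D E y : (D <= E)%N -> lattice D y -> lattice E y.
Proof. by move=> DE [c hc ->]; exists c => // i; apply: leq_trans DE. Qed.

Lemma lattice_sum D (I : finType) (f : I -> K) :
  (forall i, lattice D (f i)) -> lattice D (\sum_i f i).
Proof.
move=> h; apply: (big_ind (lattice D)) => // [|_ _ [c hc ->] [c' hc' ->]].
  exists (fun=> 0) => [i|]; first by rewrite size_poly0.
  by rewrite big1 // => i _; rewrite rmorph0 mul0r.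
exists (fun i => c i + c' i) => [i|].
  by rewrite (leq_trans (size_polyD _ _)) // geq_max hc hc'.
by rewrite -big_split; apply: eq_bigr => i _; rewrite rmorphD mulrDl.
Qed.

Lemma lattice_mul D E p y :
  (size p <= E.+1)%N -> lattice D y -> lattice (D + E) (p%:K * y).
Proof.
move=> pE [c hc ->]; exists (fun i => p * c i) => [i|].
  by rewrite (leq_trans (size_polyMleq _ _)) //; have := hc i; lia.
by rewrite mulr_sumr; apply: eq_bigr => i _; rewrite rmorphM mulrA.
Qed.

Lemma lattice_const D (c : F) y : lattice D y -> lattice D (c%:P%:K * y).
Proof.
by move=> /(@lattice_mul _ 0 c%:P); rewrite addn0; apply; apply: size_polyC_leq1.
Qed.

Lemma fraction_denominator (f : {fraction {poly F}}) :
  exists2 d, d != 0 & exists p, tofrac d * f = tofrac p.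
Proof.
elim/quotW: f => r; exists \d_r; first exact: denom_ratioP.
exists \n_r; rewrite -[_ * _]/(FracField.mul _ _) !piE; apply/eqmodP => /=.
by rewrite FracField.equivfE /FracField.mulf !numden_Ratio ?mul1r ?mulr1 ?oner_eq0 ?denom_ratioP.
Qed.

Lemma fraction_common_denominator (I : finType) (f : I -> {fraction {poly F}}) :
  exists2 d, d != 0 & forall i, exists p, tofrac d * f i = tofrac p.
Proof.
have /choice[d hd] i : exists d, d != 0 /\ exists p, tofrac d * f i = tofrac p.
  by have [d d0 dp] := fraction_denominator (f i); exists d.
exists (\prod_i d i) => [|i].
  by apply/prodf_neq0 => i _; case: (hd i).
have [_ [p dp]] := hd i; exists ((\prod_(j | j != i) d j) * p).
by rewrite (bigD1 i) //= mulrC !rmorphM /= -dp; ring.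
Qed.

Lemma lattice_common_denominator (I : finType) (y : I -> K) :
  exists2 d, d != 0 & exists D, forall i, lattice D (d%:K * y i).
Proof.
have [d d0 hd] := fraction_common_denominator
  (fun k : I * 'I_N => coord (vbasis {:K}) k.2 (y k.1)).
have [p hp] := choice hd; exists d => //; exists (\max_k size (p k)) => i.
exists (fun j => p (i, j)) => [j|]; first exact: (leq_bigmax (i, j)).
rewrite {1}(coord_vbasis (memvf (y i))) mulr_sumr; apply: eq_bigr => j _.
by rewrite /polyK /= -hp /= -scalerAl mul1r scalerA -[RHS]scalerAl mul1r.
Qed.

(** Here [d] clears the denominators of the matrix of multiplication by [x]. The same [C] bounds the
    degree growth under [d] and under [d * x], so a product of [A] such factors costs [C * A]
    however they are mixed. *)
Lemma lattice_mul_elt x : exists2 d, d != 0 & exists C, forall D y,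
  lattice D y -> lattice (D + C) (d%:K * y) /\ lattice (D + C) (d%:K * x * y).
Proof.
have [d d0 [C hC]] := lattice_common_denominator (fun i : 'I_N => x * e i).
exists d => //; exists (C + size d)%N => D y Ly; split.
  by apply: latticeW (lattice_mul (leqnSn _) Ly); rewrite leq_add2l leq_addl.
have [c hc ->] := Ly; rewrite mulr_sumr; apply: lattice_sum => i.
have -> : d%:K * x * ((c i)%:K * e i) = (c i)%:K * (d%:K * (x * e i)) by ring.
apply: latticeW (lattice_mul (leq_trans (hc i) (leqnSn _)) (hC i)); lia.
Qed.

(** Each value of [g] is recovered from [N * D] coefficients in [F]. *)
Lemma card_lattice D (T : finType) (g : T -> K) :
  injective g -> (forall t, lattice D (g t)) -> (#|T| <= #|F| ^ (N * D))%N.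
Proof.
move=> g_inj hg.
have /choice[c hc] t : exists c : 'I_N -> {poly F},
    (forall i, (size (c i) <= D)%N) /\ g t = \sum_i (c i)%:K * e i.
  by have [c h1 h2] := hg t; exists c.
pose h t : {ffun 'I_N * 'I_D -> F} := [ffun k : 'I_N * 'I_D => (c t k.1)`_k.2].
have h_inj : injective h.
  move=> t1 t2 /ffunP h12; apply: g_inj.
  have [[s1 ->] [s2 ->]] := (hc t1, hc t2).
  apply: eq_bigr => i _; congr (_ * _); congr (_ %:K); apply/polyP => k.
  have [kD|Dk] := ltnP k D; first by have := h12 (i, Ordinal kD); rewrite !ffunE.
  by rewrite !nth_default // (leq_trans _ Dk).
by have := leq_card h h_inj; rewrite card_ffun card_prod !card_ord.
Qed.

(* If u_i separates v_i from the other v_j, the x^a u_i (a < A) are free over F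
   and, up to a common denominator, lie in the lattice of coefficient degree
   O(C A); comparing cardinals as A grows bounds m by N C. *)
Lemma zeros_bounded x : exists B, forall m (v : 'I_m -> place K),
  injective v -> (forall i, 0 < v i x) -> (m <= B)%N.
Proof.
have [d d0 [C hC]] := lattice_mul_elt x.
exists (N * C)%N => m v v_inj vx; rewrite leqNgt; apply/negP => m_gt.
have /choice[u hu] i : exists u : K, v i u < 0 /\ forall j, j != i -> 0 < v j u.
  have [|z [vz wz]] := @ord_separate_seq _ (v i) [seq v j | j in predC1 i].
    by apply/negP => /imageP[j ji /v_inj ij]; rewrite ij !inE eqxx in ji.
  by exists z; split=> // j ji; apply: wz; apply: image_f.
have [d' d'0 [D hD]] := lattice_common_denominator u.
(* Counting will give [m * A <= N * (D + C * A)]; with [m > N * C] this forces [A <= N * D], which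
   this choice violates. *)
pose A := (N * D).+1.
pose g (c : {ffun 'I_m * 'I_A -> F}) :=
  \sum_k (c k)%:P%:K * ((d ^+ A)%:K * d'%:K * (x ^+ k.2 * u k.1)).
have dd0 : (d ^+ A)%:K * d'%:K != 0 by rewrite mulf_neq0 ?polyK_eq0 ?expf_neq0.
have g_inj : injective g.
  move=> c1 c2 /eqP; rewrite -subr_eq0 -sumrB => /eqP gc.
  apply/ffunP => k; apply/eqP; rewrite -subr_eq0; apply/eqP; move: k.
  apply: (@separated_powers_free x m A v u) => //.
  - by move=> i; case: (hu i).
  - by move=> i j ij; case: (hu j) => _; apply.
  apply: (mulfI dd0); rewrite mulr0 -[RHS]gc mulr_sumr; apply: eq_bigr => k _.
  by rewrite mulrCA polyCB rmorphB mulrBl.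
have gL c : lattice (D + C * A) (g c).
  apply: lattice_sum => -[i a]; apply: lattice_const => /=.
  (* The [A] copies of [d] are shared out: one to each of the [a] factors [x], the remaining [A - a]
     left alone. *)
  have -> : (d ^+ A)%:K * d'%:K * (x ^+ a * u i) =
      d%:K ^+ (A - a) * ((d%:K * x) ^+ a * (d'%:K * u i)).
    rewrite rmorphXn -{1}(subnK (ltnW (ltn_ord a))) exprD exprMn.
    by rewrite -!mulrA [d'%:K * _]mulrCA.
  have L1 k z E : lattice E z -> lattice (E + C * k) ((d%:K * x) ^+ k * z).
    move=> Lz; elim: k => [|k IH]; first by rewrite expr0 mul1r muln0 addn0.
    by rewrite exprS -[_ * _ ^+ k * z]mulrA mulnS addnCA addnC; apply: (hC _ _ IH).2.
  have L2 k z E : lattice E z -> lattice (E + C * k) (d%:K ^+ k * z).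
    move=> Lz; elim: k => [|k IH]; first by rewrite expr0 mul1r muln0 addn0.
    by rewrite exprS -[_ * _ ^+ k * z]mulrA mulnS addnCA addnC; apply: (hC _ _ IH).1.
  have := L2 (A - a)%N _ _ (L1 a _ _ (hD i)).
  by rewrite -addnA -mulnDr subnKC // ltnW.
have := card_lattice g_inj gL.
rewrite card_ffun card_prod !card_ord leq_exp2l ?finNzRing_gt1 // /A.
by move: m_gt; clear; nia.
Qed.

(** By [zeros_bounded] some finite set of zeros has maximal size, hence contains them all; poles are
    zeros of [x^-1]. *)
Lemma finite_support x : exists s : {fset place K}, forall v, v x != 0 -> v \in s.
Proof.
have pos y : exists s : {fset place K}, forall v, 0 < v y -> v \in s.
  have [B hB] := zeros_bounded y.
  pose P (k : nat) := `[< exists s : {fset place K},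
    #|` s| = k /\ forall v, v \in s -> 0 < v y >].
  have P0 : exists k, P k.
    by exists 0%N; apply/asboolP; exists fset0; split; [exact: cardfs0|].
  have PB k : P k -> (k <= B)%N.
    move=> /asboolP[s [<- hs]].
    apply: (hB _ (fun i : 'I_#|` s| => tnth (in_tuple (enum_fset s)) i)).
      by apply/tuple_uniqP; apply: fset_uniq.
    by move=> i; apply: hs; apply: mem_tnth.
  case: (ex_maxnP P0 PB) => k /asboolP[s [sk hs]] kmax.
  exists s => v vy; apply: contraT => vs.
  have /kmax : P k.+1.
    apply/asboolP; exists (v |` s)%fset; rewrite cardfsU1 vs sk; split=> // w.
    by rewrite in_fset1U => /orP[/eqP->|/hs].
  by rewrite ltnn.
have [s1 h1] := pos x; have [s2 h2] := pos x^-1.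
exists (s1 `|` s2)%fset => v; rewrite in_fsetU neq_lt => /orP[vx|/h1->//].
by rewrite h2 ?orbT // ordV oppr_gt0.
Qed.
End FunctionField.

(** * Squares in the completions *)

Section LocalSquares.
Variables (K : fieldType) (v : place K).
Implicit Types x y : K.

Lemma to_completionM x y :
  to_completion v (x * y) = to_completion v x * to_completion v y.
Proof. by rewrite /to_completion -rmorphM; congr (\pi _)%qT; apply: val_inj. Qed.

Lemma local_square_sqr x : local_square v (x ^+ 2).
Proof. by exists (to_completion v x); rewrite !expr2 to_completionM. Qed.

Lemma local_squareM x y :
  local_square v x -> local_square v y -> local_square v (x * y).
Proof.
by move=> [a xa] [b yb]; exists (a * b); rewrite to_completionM xa yb exprMn.
Qed.

Lemma local_square1 : local_square v 1.
Proof. by have := local_square_sqr 1; rewrite expr1n. Qed.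

Lemma local_square_prod (I : finType) (P : pred I) (f : I -> K) :
  (forall i, P i -> local_square v (f i)) -> local_square v (\prod_(i | P i) f i).
Proof.
by move=> h; apply: (big_ind (local_square v)) => //;
   [apply: local_square1 | apply: local_squareM].
Qed.

(** Only the ring structure of the completion is available, so the division by [y] is done in [K]:
    multiply by [y], then by the square of [y^-1]. *)
Lemma local_squareMr x y :
  y != 0 -> local_square v y -> local_square v (x * y) -> local_square v x.
Proof.
move=> y0 sy sxy; have -> : x = x * y * y * (y^-1) ^+ 2.
  by rewrite expr2 mulrA !mulfK.
by apply: local_squareM; [apply: local_squareM | apply: local_square_sqr].
Qed.

Lemma residue_symbol1 x : residue_symbol v x = 1 -> local_square v x.
Proof. by rewrite /residue_symbol; case: asboolP => // _; case: ifP. Qed.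

Lemma residue_symbolN1 x : residue_symbol v x = -1 -> ~ local_square v x.
Proof. by rewrite /residue_symbol; case: asboolP. Qed.
End LocalSquares.

(** * Relations between places in Pic X / 2 Pic X *)

Section Independence.
Variable K : fieldType.
Local Notation divisor := {freeg (place K) / int}.

(** The class of the sum of places is twice that of [- D], hence vanishes modulo 2 Pic X. *)
Lemma place_class_sum_eq0 (s : seq (place K)) (c : place K -> bool) (D : divisor) :
  principal (\sum_(v <- s) << v >> *+ c v + D *+ 2) ->
  \sum_(v <- s) place_class v *+ c v = 0.
Proof.
set E := \sum_(v <- s) _ => prE.
have -> : \sum_(v <- s) place_class v *+ c v =
    (\pi_{ideal_quot two_Pic K} (divisor_class E))%qT.
  rewrite /divisor_class !raddf_sum; apply: eq_bigr => v _.
  by rewrite !raddfMn.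
rewrite -[RHS](raddf0 (\pi_{ideal_quot two_Pic K})%qT).
apply/eqP; rewrite -Quotient.idealrBE subr0.
apply/asboolP; exists (divisor_class (- D)).
rewrite /divisor_class -raddfMn; apply/eqP.
by rewrite -Quotient.idealrBE mulNrn opprK.
Qed.

End Independence.

Lemma ord_exp_prod (K : fieldType) (v : place K) (I : finType) (a : I -> K)
    (c : I -> bool) :
  (forall i, a i != 0) -> v (\prod_i a i ^+ c i) = \sum_i v (a i) *+ c i.
Proof.
move=> a0; rewrite ord_prod => [|i]; last exact: expf_neq0.
by apply: eq_bigr => i _; rewrite ordX.
Qed.

Lemma exp_prod_neq0 (K : fieldType) (I : finType) (a : I -> K) (c : I -> bool) :
  (forall i, a i != 0) -> \prod_i a i ^+ c i != 0.
Proof. by move=> a0; apply/prodf_neq0 => i _; rewrite expf_neq0. Qed.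

(* The odd part of div x is supported on T and equals -2 D modulo principal
   divisors, D being half of the even part. *)
Lemma independent_singular (F : finFieldType) (K : fieldExtType {fraction {poly F}})
    (T : {fset place K}) (x : K) :
  independent_places T -> singular T x -> singular fset0 x.
Proof.
move=> indT [x0 hx]; split=> // v _.
have [vT|/hx//] := boolP (v \in T).
have [s hs] := finite_support x.
pose c (w : place K) := (w x %% 2)%Z == 1.
suff : c v = false by rewrite /c => /eqP; lia.
(* Each order is its remainder plus twice its floored half, so [D] makes the divisor in
   [place_class_sum_eq0] equal to div [x]: off [T] the remainder is 0 by singularity, off [s] the
   order itself is 0. *)
apply: indT vT; pose D : {freeg (place K) / int} := \sum_(w <- s) << (w x %/ 2)%Z *g w >>.
apply: (@place_class_sum_eq0 _ _ _ D); apply/asboolP; exists x => // w.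
have coeff_sum (t : {fset place K}) (f : place K -> int) :
    coeff w (\sum_(u <- t) << f u *g u >>) = if w \in t then f w else 0.
  rewrite raddf_sum /= (eq_bigr (fun u => if u == w then f u else 0)); last first.
    by move=> u _; rewrite coeffU; case: eqP => _; rewrite ?mulr1 ?mulr0.
  have [wt|wt] := boolP (w \in t).
    rewrite (big_fsetD1 w) //= eqxx big_seq big1 ?addr0 // => u.
    by rewrite in_fsetD1 => /andP[/negPf->].
  by rewrite big_seq big1 // => u ut; case: eqP => // uw; rewrite -uw ut in wt.
rewrite coeffD coeffMn coeff_sum.
under eq_bigr => u _ do rewrite freegU_muln.
rewrite (coeff_sum T (fun u => (c u)%:R)) /c.
have := hs w; have := hx w; case: (w \in T); case: (w \in s) => /= h1 h2.
- by case: eqP; lia.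
- have -> : w x = 0 by apply: contraTeq isT => /h2.
  by [].
- by have := h1 isT; lia.
- by have -> : w x = 0 by apply: contraTeq isT => /h2.
Qed.

(** * The basis and the coordinates *)

Theorem proposition6
  (F : finFieldType) (hF : 2%N \notin [pchar F])
  (K : fieldExtType {fraction {poly F}}) (hK : full_constant_field K)
  (n : nat) (beta : 'I_n -> K) (hbeta : singular_basis fset0 beta)
  (b : 'I_n -> place K) (hb : compatible beta b)
  (S : {fset place K}) (hSb : forall i, b i \notin S)
  (S' : {fset place K}) (hS' : maximal_independent S S')
  (s : nat) (p : 'I_s -> place K) (p_inj : injective p)
  (hp : forall P : place K, (P \in (S `\` S')%fset) <-> (exists j, P = p j))
  (lambda : 'I_s -> K)
  (lambda_sing : forall j, singular (p j |` S')%fset (lambda j))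
  (lambda_ord : forall j, (p j (lambda j) = 1 %[mod 2])%Z)
  (lambda_sym : forall j i, residue_symbol (b i) (lambda j) = 1) :
  singular_basis S
    (fun k : 'I_n + 'I_s => match k with inl i => beta i | inr j => lambda j end)
  /\
  (forall mu : K, singular S mu ->
   forall (eps : 'I_n -> bool) (e : 'I_s -> bool),
     eq_mod_squares mu
       ((\prod_(i < n) beta i ^+ eps i) * (\prod_(j < s) lambda j ^+ e j)) ->
     (forall i, (-1) ^+ eps i = residue_symbol (b i) mu) /\
     (forall j, ((e j)%:Z = p j mu %[mod 2])%Z)).
Proof.
have beta0 i : beta i != 0 by case: hbeta => h _ _; case: (h i).
have lambda0 j : lambda j != 0 by case: (lambda_sing j).
have [S'S indS' _] := hS'.
have beta_even i (v : place K) : (2 %| v (beta i))%Z.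
  by case: hbeta => h _ _; have [_ /(_ v)] := h i; rewrite in_fset0 => /(_ isT); lia.
have prodB_even (eps : 'I_n -> bool) (v : place K) : (2 %| v (\prod_i beta i ^+ eps i))%Z.
  by rewrite ord_exp_prod //; apply: rpred_sum => i _; apply: rpredMn.
have pS j : p j \in (S `\` S')%fset by apply/hp; exists j.
have lambda_even j (v : place K) : v \notin S' -> v != p j -> (2 %| v (lambda j))%Z.
  move=> vS' vj; have [_ /(_ v)] := lambda_sing j.
  by rewrite in_fset1U negb_or vj vS' => /(_ isT); lia.
have prodL_ord (e : 'I_s -> bool) j : (2 %| p j (\prod_k lambda k ^+ e k) - (e j)%:Z)%Z.
  have ej : (2 %| p j (lambda j) *+ e j - (e j)%:Z)%Z.
    by have := lambda_ord j; case: (e j); rewrite ?mulr1n ?mulr0n; lia.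
  rewrite ord_exp_prod // (bigD1 j) //= addrAC; apply: rpredD => //.
  apply: rpred_sum => k kj; apply: rpredMn; apply: lambda_even.
    by have := pS j; rewrite in_fsetD => /andP[].
  by rewrite (inj_eq p_inj) eq_sym.
have pE (eps : 'I_n -> bool) (e : 'I_s -> bool) j :
    (2 %| p j ((\prod_i beta i ^+ eps i) * \prod_k lambda k ^+ e k) - (e j)%:Z)%Z.
  rewrite ord_mul ?exp_prod_neq0 // -addrA; exact: rpredD.
split; last first.
  move=> mu [mu0 mu_even] eps e [z z0 muE]; split=> [i|j]; last first.
    rewrite muE ord_mul ?mulf_neq0 ?exp_prod_neq0 ?expf_neq0 // ordX.
    by have := pE eps e j; move: (p j (_ * _)) (p j z) (Posz _) => ? ? ?; lia.
  (* All factors of [mu] other than the power of [beta i] are gathered in [y], a square at [b i]. *)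
  pose y := \prod_(k | k != i) beta k ^+ eps k * (\prod_j lambda j ^+ e j * z ^+ 2).
  have {}muE : mu = beta i ^+ eps i * y by rewrite muE (bigD1 i) //= !mulrA.
  have y0 : y != 0 by move: mu0; rewrite muE mulf_eq0 negb_or => /andP[].
  have squareX (x : K) (k : bool) : local_square (b i) x -> local_square (b i) (x ^+ k).
    by case: k => // _; apply: local_square1.
  have ysq : local_square (b i) y.
    apply: local_squareM.
      apply: local_square_prod => k ki; apply/squareX/residue_symbol1.
      by apply: hb.2.
    apply: local_squareM; last exact: local_square_sqr.
    by apply: local_square_prod => j _; apply/squareX/residue_symbol1.
  (* Since [b i] is not in [S], the order of [mu] there is even, which rules out the symbol 0. *)
  have mu_ord := mu_even _ (hSb i).
  rewrite /residue_symbol; case: asboolP => musq; move: musq muE; case: (eps i).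
  - move=> musq muE; rewrite muE expr1 in musq.
    by case: (residue_symbolN1 (hb.1 i)); apply: local_squareMr musq.
  - by [].
  - by move=> _ _; rewrite expr1; case: eqP => //; lia.
  - by move=> musq muE; case: musq; rewrite muE expr0 mul1r.
split.
- case=> [i|j].
    by split=> // v _; have := beta_even i v; lia.
  have [_ h] := lambda_sing j; split=> // v vS; apply: h.
  apply: contra vS; rewrite in_fset1U => /orP[/eqP->|]; last exact: (fsubsetP S'S).
  by have := pS j; rewrite in_fsetD => /andP[].
- move=> c; rewrite big_sumType /= => -[z z0 cz].
  (* The parity at [p j] kills the [lambda] exponents; what remains is a relation between the
     [beta i]. *)
  have cr j : c (inr j) = false.
    have := pE (c \o inl) (c \o inr) j; rewrite cz mul1r ordX /=.
    by case: (c (inr j)) => //; lia.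
  move: cz; rewrite [X in _ * X]big1 => [|j _]; last by rewrite cr.
  rewrite mulr1 => cz [i|//].
  by have [_ h _] := hbeta; apply: (h (c \o inl)); exists z.
move=> x [x0 hx].
pose e j := (p j x %% 2)%Z == 1.
pose L := \prod_k lambda k ^+ e k.
have L0 : L != 0 by apply: exp_prod_neq0.
have [_ _ h] := hbeta.
have /h[eps [z z0 xE]] : singular fset0 (x * L).
  (* At each [p j] the parities of [x] and [L] agree and cancel; outside [S] both orders are
     even. *)
  apply: (independent_singular indS'); split=> [|v vS']; first exact: mulf_neq0.
  rewrite ord_mul //; have [vS|vS] := boolP (v \in S).
    have /hp[j ->] : v \in (S `\` S')%fset by rewrite in_fsetD vS vS'.
    have ej : (e j)%:Z = (p j x %% 2)%Z by rewrite /e; case: eqP => /=; lia.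
    by have := prodL_ord e j; rewrite -/L ej; move: (p j x) (p j L) => ? ?; lia.
  have : (2 %| v L)%Z; last by have := hx v vS; lia.
  rewrite ord_exp_prod //; apply: rpred_sum => k _; apply: rpredMn; apply: lambda_even => //.
  by apply: contraNneq vS => ->; have := pS k; rewrite in_fsetD => /andP[].
exists (fun k => match k with inl i => eps i | inr j => e j end).
(* From [x * L = B * z ^+ 2], with [B] the product of the [beta i ^+ eps i], one gets
   [x = B * L * (z / L) ^+ 2]. *)
exists (z / L); first by rewrite mulf_neq0 ?invr_eq0.
rewrite big_sumType /= -/L; apply: (mulIf L0); rewrite xE.
by rewrite expr_div_n -!mulrA; congr (_ * _); rewrite [in RHS]expr2; field.
Qed.
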